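(* Let $\alpha_0,\alpha_1\in\mathbb{C}$ with $\alpha_0+\alpha_1=0$. Consider the system of partial differential equations in the variables $t_1,t_2,t_3$ $$dq_m=\sum_{i=1}^{3}\frac{\partial K_i}{\partial p_m}\,dt_i,\qquad dp_m=-\sum_{i=1}^{3}\frac{\partial K_i}{\partial q_m}\,dt_i\qquad(m=1,2),$$ with the polynomial Hamiltonians $K_1,K_2,K_3$ given in the context. This system satisfies the compatibility conditions $$\frac{\partial}{\partial t_j}\frac{\partial q_1}{\partial t_i}=\frac{\partial}{\partial t_i}\frac{\partial q_1}{\partial t_j},\quad \frac{\partial}{\partial t_j}\frac{\partial p_1}{\partial t_i}=\frac{\partial}{\partial t_i}\frac{\partial p_1}{\partial t_j},\quad \frac{\partial}{\partial t_j}\frac{\partial q_2}{\partial t_i}=\frac{\partial}{\partial t_i}\frac{\partial q_2}{\partial t_j},\quad \frac{\partial}{\partial t_j}\frac{\partial p_2}{\partial t_i}=\frac{\partial}{\partial t_i}\frac{\partial p_2}{\partial t_j}$$ for all $i,j\in\{1,2,3\}$.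
   Context: The Hamiltonians are $$K_1=q_1p_1^2+q_1^2-\alpha_0p_1+\tfrac14q_2^2-\tfrac14p_2^2+p_1q_2p_2,$$ $$K_2=q_2^2p_2^2-\tfrac14q_2^2+\tfrac14p_2^2-2\alpha_0q_2p_2+q_1q_2^2+q_1p_2^2-p_1q_2p_2+p_1^2q_2^2,$$ $$\begin{aligned}K_3=&\tfrac12q_1^2p_1^4+q_1^3p_1^2+\tfrac12q_1^4-\alpha_0q_1p_1^3+\alpha_1q_1^2p_1+\tfrac12\alpha_0^2p_1^2+\tfrac1{32}q_2^4+\tfrac1{32}p_2^4-\tfrac1{16}q_2^2p_2^2+q_1p_1^3q_2p_2\\&+\tfrac12p_1^2q_2^2p_2^2-\tfrac14q_1p_1^2p_2^2-\tfrac14p_1q_2p_2^3+q_1^2p_1q_2p_2+\tfrac14q_1p_1^2q_2^2+\tfrac14p_1q_2^3p_2-\alpha_0p_1^2q_2p_2\\&+\tfrac14\alpha_0p_1p_2^2+\tfrac14\alpha_1p_1q_2^2+\tfrac14q_1^2q_2^2-\tfrac14q_1^2p_2^2.\end{aligned}$$ In the compatibility conditions, the derivatives $\partial/\partial t_i$ of polynomials in $q_1,p_1,q_2,p_2$ are computed by the chain rule using the system, and the identities hold identically as polynomials in $q_1,p_1,q_2,p_2$. *)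

(* Defs.v *)
From HB Require Import structures.
From mathcomp Require Import all_boot all_order all_algebra.
From mathcomp.real_closed Require Export complex.
From mathcomp Require Export reals mpoly.

Set Implicit Arguments.
Unset Strict Implicit.
Unset Printing Implicit Defensive.

Import GRing.Theory.
Local Open Scope ring_scope.

(* The index m : 'I_2 is zero-based: m = 0, 1 stands for (q_1, p_1), (q_2, p_2).
   Polynomials in the canonical variables are in the order q_1, q_2, p_1, p_2,
   so that q_m is the variable lshift 2 m and p_m the variable rshift 2 m. *)
Definition qvar (m : 'I_2) : 'I_(2 + 2) := lshift 2 m.
Definition pvar (m : 'I_2) : 'I_(2 + 2) := rshift 2 m.

Section System.
Variables (F : fieldType) (alpha0 alpha1 : F).

Local Notation poly4 := {mpoly F[2 + 2]}.
Local Notation q1 := ('X_(qvar ord0) : poly4).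
Local Notation p1 := ('X_(pvar ord0) : poly4).
Local Notation q2 := ('X_(qvar ord_max) : poly4).
Local Notation p2 := ('X_(pvar ord_max) : poly4).
Local Notation a0 := (alpha0%:MP : poly4).
Local Notation a1 := (alpha1%:MP : poly4).
Local Notation half := ((1 / 2)%:MP : poly4).
Local Notation quarter := ((1 / 4)%:MP : poly4).

Definition K1 : poly4 :=
  q1 * p1 ^+ 2 + q1 ^+ 2 - a0 * p1 + quarter * q2 ^+ 2 - quarter * p2 ^+ 2
  + p1 * q2 * p2.

Definition K2 : poly4 :=
  q2 ^+ 2 * p2 ^+ 2 - quarter * q2 ^+ 2 + quarter * p2 ^+ 2
  - 2 * a0 * q2 * p2 + q1 * q2 ^+ 2 + q1 * p2 ^+ 2 - p1 * q2 * p2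
  + p1 ^+ 2 * q2 ^+ 2.

Definition K3 : poly4 :=
  half * q1 ^+ 2 * p1 ^+ 4 + q1 ^+ 3 * p1 ^+ 2 + half * q1 ^+ 4
  - a0 * q1 * p1 ^+ 3 + a1 * q1 ^+ 2 * p1 + half * a0 ^+ 2 * p1 ^+ 2
  + (1 / 32)%:MP * q2 ^+ 4 + (1 / 32)%:MP * p2 ^+ 4
  - (1 / 16)%:MP * q2 ^+ 2 * p2 ^+ 2 + q1 * p1 ^+ 3 * q2 * p2
  + half * p1 ^+ 2 * q2 ^+ 2 * p2 ^+ 2 - quarter * q1 * p1 ^+ 2 * p2 ^+ 2
  - quarter * p1 * q2 * p2 ^+ 3 + q1 ^+ 2 * p1 * q2 * p2
  + quarter * q1 * p1 ^+ 2 * q2 ^+ 2 + quarter * p1 * q2 ^+ 3 * p2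
  - a0 * p1 ^+ 2 * q2 * p2
  + quarter * a0 * p1 * p2 ^+ 2 + quarter * a1 * p1 * q2 ^+ 2
  + quarter * q1 ^+ 2 * q2 ^+ 2 - quarter * q1 ^+ 2 * p2 ^+ 2.

(* Zero-based as well: i = 0, 1, 2 stands for K_1, K_2, K_3 and the time
   variables t_1, t_2, t_3. *)
Definition K (i : 'I_3) : poly4 := tnth [tuple K1; K2; K3] i.

(* The coefficients of dt_i in dq_m and dp_m. *)
Definition dqdt (i : 'I_3) (m : 'I_2) : poly4 := (K i)^`M(pvar m).
Definition dpdt (i : 'I_3) (m : 'I_2) : poly4 := - (K i)^`M(qvar m).

(* d/dt_i of a polynomial in the canonical variables, by the chain rule along
   the system. *)
Definition ddt (i : 'I_3) (f : poly4) : poly4 :=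
  \sum_(m < 2) (f^`M(qvar m) * dqdt i m + f^`M(pvar m) * dpdt i m).

End System.

(* Main.v *)
Require Import Defs.
From HB Require Import structures.
From mathcomp Require Import all_boot all_order all_algebra.
From mathcomp Require Import ring.
Import GRing.Theory.
Local Open Scope ring_scope.
Local Open Scope complex_scope.

(* d/dt_i is the Poisson bracket with K_i. By the product rule and the symmetry
   of second derivatives, the two sides of each compatibility condition differ
   by a partial derivative of {K_i, K_j}, so it suffices that the three
   Hamiltonians are in involution, which is a polynomial identity once alpha1
   is replaced by - alpha0. *)

Section Compatibility.
Variables (F : fieldType) (alpha0 alpha1 : F).

Local Notation K := (K alpha0 alpha1).
Local Notation ddt := (ddt alpha0 alpha1).

Lemma ddtE (i : 'I_3) (f : {mpoly F[2 + 2]}) :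
  ddt i f =
    f^`M(qvar ord0) * (K i)^`M(pvar ord0)
    - f^`M(pvar ord0) * (K i)^`M(qvar ord0)
    + (f^`M(qvar ord_max) * (K i)^`M(pvar ord_max)
       - f^`M(pvar ord_max) * (K i)^`M(qvar ord_max)).
Proof.
by rewrite /Defs.ddt big_ord_recr big_ord1 /dqdt /dpdt /= !mulrN;
  (* The indices left by expanding the sum agree with [ord0] and [ord_max] only in value. *)
  congr (_ * _^`M(_) - _^`M(_) * _^`M(_) + _);
  do ?congr (_^`M(_)); apply: val_inj.
Qed.

Lemma ddt_sym (i j : 'I_3) : ddt j (K i) = - ddt i (K j).
Proof. rewrite !ddtE; ring. Qed.

(** Leibniz rule for the bracket: the derivative of {K_i, K_j} is {K_i', K_j} + {K_i, K_j'}, and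
    antisymmetry turns the second term into [- ddt i] of K_j'. *)
Lemma ddt_mderiv_sub (i j : 'I_3) (v : 'I_(2 + 2)) :
  ddt j (K i)^`M(v) - ddt i (K j)^`M(v) = (ddt j (K i))^`M(v).
Proof.
rewrite !ddtE !(mderivD, mderivN, mderivM).
(* Mixed second derivatives are put in one order, so that [ring] sees equal ones as the same
   atom. *)
rewrite !(mderiv_comm _ v); ring.
Qed.

Lemma ddtN (i : 'I_3) f : ddt i (- f) = - ddt i f.
Proof. rewrite !ddtE !mderivN; ring. Qed.

End Compatibility.

Lemma mderiv_var (R : comNzRingType) n (i j : 'I_n) :
  ('X_j : {mpoly R[n]})^`M(i) = (j == i)%:R.
Proof.
rewrite mderivX mnm1E; case: eqP => [->|_]; last by rewrite scale0r.
by rewrite -{1}[U_(i)%MM]add0m addmK mpolyX0 scale1r.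
Qed.

Lemma mderivXn (R : comNzRingType) n (i : 'I_n) (f : {mpoly R[n]}) k :
  (f ^+ k)^`M(i) = k%:R * f ^+ k.-1 * f^`M(i).
Proof.
elim: k => [|k IHk]; first by rewrite expr0 -mpolyC1 mderivC !mul0r.
(* The split is there because [k.-1.+1 = k] holds only for positive [k]. *)
rewrite exprS mderivM IHk; case: k {IHk} => [|k] /=; first by rewrite !expr0; ring.
rewrite exprS; ring.
Qed.

Lemma mderiv_nat (R : comNzRingType) n (i : 'I_n) k :
  (k%:R : {mpoly R[n]})^`M(i) = 0.
Proof. by rewrite -mpolyC_nat mderivC. Qed.

Section Involution.
Variables (F : fieldType) (alpha0 alpha1 : F).

Local Notation q1 := ('X_(qvar ord0) : {mpoly F[2 + 2]}).
Local Notation p1 := ('X_(pvar ord0) : {mpoly F[2 + 2]}).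
Local Notation q2 := ('X_(qvar ord_max) : {mpoly F[2 + 2]}).
Local Notation p2 := ('X_(pvar ord_max) : {mpoly F[2 + 2]}).
Local Notation a0 := (alpha0%:MP : {mpoly F[2 + 2]}).
Local Notation a1 := (alpha1%:MP : {mpoly F[2 + 2]}).
Local Notation quarter := ((1 / 4)%:MP : {mpoly F[2 + 2]}).
Local Notation c32 := ((1 / 32)%:MP : {mpoly F[2 + 2]}).

Hypothesis two_neq0 : (2 : F) != 0.

(** Brings fractions to a common denominator [n], leaving a single inverse for [ring] to treat as an
    atom. *)
Lemma unit_fracC (n k d : nat) : n = (k * d)%N -> (n%:R : F) != 0 ->
  (1 / d%:R)%:MP = k%:R * (1 / n%:R)%:MP :> {mpoly F[2 + 2]}.
Proof.
move=> ->; rewrite natrM mulf_eq0 negb_or => /andP[k0 d0].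
by rewrite -mpolyC_nat -mpolyCM !div1r invfM mulrA divff ?mul1r.
Qed.

Let pow2_neq0 k : ((2 ^ k)%:R : F) != 0.
Proof. by rewrite natrX expf_neq0. Qed.

(* The factored forms have integer polynomials, whose Poisson brackets [ring]
   can normalize without knowing that [2] is invertible. *)
Lemma K1E :
  K1 alpha0 =
  quarter * (4 * q1 ^+ 2 + 4 * q1 * p1 ^+ 2 + 4 * p1 * q2 * p2 + q2 ^+ 2
             - p2 ^+ 2 - 4 * a0 * p1).
Proof.
rewrite /K1.
have quarterE : 4 * quarter = 1.
  (* With [d = 1] the fraction is the constant 1, and the lemma read backwards is the claim. *)
  by rewrite -(@unit_fracC 4 4 1) ?divr1 ?(pow2_neq0 2).
(* [ring: c] applies an equation such as [4 * c = 1] only to monomials with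
   coefficient exactly [4], so the multiples that occur are supplied too. *)
have quarterNE : - (4 * quarter) = -1 by rewrite quarterE.
by move: quarter quarterE quarterNE => c c1 c2; ring: c1 c2.
Qed.

Lemma K2E :
  K2 alpha0 =
  quarter * (4 * q1 * q2 ^+ 2 + 4 * q1 * p2 ^+ 2 + 4 * p1 ^+ 2 * q2 ^+ 2
             - 4 * p1 * q2 * p2 + 4 * q2 ^+ 2 * p2 ^+ 2 - q2 ^+ 2 + p2 ^+ 2
             - 8 * a0 * q2 * p2).
Proof.
rewrite /K2.
have quarterE : 4 * quarter = 1.
  by rewrite -(@unit_fracC 4 4 1) ?divr1 ?(pow2_neq0 2).
have quarterNE : - (4 * quarter) = -1 by rewrite quarterE.
have quarter2NE : - (8 * quarter) = -2.
  by rewrite (natrM _ 2 4) -mulrA quarterE mulr1.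
by move: quarter quarterE quarterNE quarter2NE => c c1 c2 c3; ring: c1 c2 c3.
Qed.

Lemma K3E :
  K3 alpha0 alpha1 =
  c32 * (16 * q1 ^+ 4 + 32 * q1 ^+ 3 * p1 ^+ 2 + 16 * q1 ^+ 2 * p1 ^+ 4
         + 32 * q1 ^+ 2 * p1 * q2 * p2 + 8 * q1 ^+ 2 * q2 ^+ 2
         - 8 * q1 ^+ 2 * p2 ^+ 2 + 32 * q1 * p1 ^+ 3 * q2 * p2
         + 8 * q1 * p1 ^+ 2 * q2 ^+ 2 - 8 * q1 * p1 ^+ 2 * p2 ^+ 2
         + 16 * p1 ^+ 2 * q2 ^+ 2 * p2 ^+ 2 + 8 * p1 * q2 ^+ 3 * p2
         - 8 * p1 * q2 * p2 ^+ 3 + q2 ^+ 4 - 2 * q2 ^+ 2 * p2 ^+ 2 + p2 ^+ 4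
         + 32 * a1 * q1 ^+ 2 * p1 - 32 * a0 * q1 * p1 ^+ 3
         - 32 * a0 * p1 ^+ 2 * q2 * p2 + 8 * a1 * p1 * q2 ^+ 2
         + 8 * a0 * p1 * p2 ^+ 2 + 16 * a0 ^+ 2 * p1 ^+ 2).
Proof.
rewrite /K3.
have n32_neq0 := pow2_neq0 5.
have c32E : 32 * c32 = 1 by rewrite -(@unit_fracC 32 32 1) ?divr1.
have c32NE : - (32 * c32) = -1 by rewrite c32E.
(* Halves, quarters and sixteenths become 16, 8 and 2 times [c32]. *)
rewrite (@unit_fracC 32 16 2) // (@unit_fracC 32 8 4) // (@unit_fracC 32 2 16) //.
by move: c32 c32E c32NE => c c1 c2; ring: c1 c2.
Qed.

Let mderivE := (mderivD, mderivN, mderivXn, mderivM, mderivC, mderiv_nat).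

Lemma mderiv_K1 v :
  (K1 alpha0)^`M(v) =
    quarter * ((8 * q1 + 4 * p1 ^+ 2) * q1^`M(v)
               + (8 * q1 * p1 + 4 * q2 * p2 - 4 * a0) * p1^`M(v)
               + (4 * p1 * p2 + 2 * q2) * q2^`M(v)
               + (4 * p1 * q2 - 2 * p2) * p2^`M(v)).
Proof. by rewrite K1E mderiv_mulC !mderivE /=; ring. Qed.

Lemma mderiv_K2 v :
  (K2 alpha0)^`M(v) =
    quarter * ((4 * q2 ^+ 2 + 4 * p2 ^+ 2) * q1^`M(v)
               + (8 * p1 * q2 ^+ 2 - 4 * q2 * p2) * p1^`M(v)
               + (8 * q1 * q2 + 8 * p1 ^+ 2 * q2 - 4 * p1 * p2
                  + 8 * q2 * p2 ^+ 2 - 2 * q2 - 8 * a0 * p2) * q2^`M(v)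
               + (8 * q1 * p2 - 4 * p1 * q2 + 8 * q2 ^+ 2 * p2 + 2 * p2
                  - 8 * a0 * q2) * p2^`M(v)).
Proof. by rewrite K2E mderiv_mulC !mderivE /=; ring. Qed.

Lemma mderiv_K3 v :
  (K3 alpha0 alpha1)^`M(v) =
    c32 * ((64 * q1 ^+ 3 + 96 * q1 ^+ 2 * p1 ^+ 2 + 32 * q1 * p1 ^+ 4
            + 64 * q1 * p1 * q2 * p2 + 16 * q1 * q2 ^+ 2 - 16 * q1 * p2 ^+ 2
            + 32 * p1 ^+ 3 * q2 * p2 + 8 * p1 ^+ 2 * q2 ^+ 2
            - 8 * p1 ^+ 2 * p2 ^+ 2 + 64 * a1 * q1 * p1
            - 32 * a0 * p1 ^+ 3) * q1^`M(v)
           + (64 * q1 ^+ 3 * p1 + 64 * q1 ^+ 2 * p1 ^+ 3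
              + 32 * q1 ^+ 2 * q2 * p2 + 96 * q1 * p1 ^+ 2 * q2 * p2
              + 16 * q1 * p1 * q2 ^+ 2 - 16 * q1 * p1 * p2 ^+ 2
              + 32 * p1 * q2 ^+ 2 * p2 ^+ 2 + 8 * q2 ^+ 3 * p2
              - 8 * q2 * p2 ^+ 3 + 32 * a1 * q1 ^+ 2
              - 96 * a0 * q1 * p1 ^+ 2 - 64 * a0 * p1 * q2 * p2
              + 8 * a1 * q2 ^+ 2 + 8 * a0 * p2 ^+ 2
              + 32 * a0 ^+ 2 * p1) * p1^`M(v)
           + (32 * q1 ^+ 2 * p1 * p2 + 16 * q1 ^+ 2 * q2
              + 32 * q1 * p1 ^+ 3 * p2 + 16 * q1 * p1 ^+ 2 * q2
              + 32 * p1 ^+ 2 * q2 * p2 ^+ 2 + 24 * p1 * q2 ^+ 2 * p2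
              - 8 * p1 * p2 ^+ 3 + 4 * q2 ^+ 3 - 4 * q2 * p2 ^+ 2
              - 32 * a0 * p1 ^+ 2 * p2 + 16 * a1 * p1 * q2) * q2^`M(v)
           + (32 * q1 ^+ 2 * p1 * q2 - 16 * q1 ^+ 2 * p2
              + 32 * q1 * p1 ^+ 3 * q2 - 16 * q1 * p1 ^+ 2 * p2
              + 32 * p1 ^+ 2 * q2 ^+ 2 * p2 + 8 * p1 * q2 ^+ 3
              - 24 * p1 * q2 * p2 ^+ 2 - 4 * q2 ^+ 2 * p2 + 4 * p2 ^+ 3
              - 32 * a0 * p1 ^+ 2 * q2 + 16 * a0 * p1 * p2) * p2^`M(v)).
Proof.
rewrite K3E mderiv_mulC; congr (_ * _).
by rewrite !mderivE /=; ring.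
Qed.

Hypothesis halpha : alpha0 + alpha1 = 0.

Let a1E : a1 = - a0.
Proof. by apply/eqP; rewrite -addr_eq0 -rmorphD addrC halpha. Qed.

Lemma ddt_K12 : ddt alpha0 alpha1 0 (K alpha0 alpha1 1) = 0.
Proof.
rewrite ddtE /K !(tnth_nth 0) /= !mderiv_K1 !mderiv_K2 !mderiv_var /=.
ring.
Qed.

Lemma ddt_K13 : ddt alpha0 alpha1 0 (K alpha0 alpha1 2) = 0.
Proof.
(* [K3] contains [alpha1], so [a1E] is substituted before [ring] compares coefficients. *)
rewrite ddtE /K !(tnth_nth 0) /= !mderiv_K1 !mderiv_K3 !mderiv_var a1E /=.
ring.
Qed.

Lemma ddt_K23 : ddt alpha0 alpha1 1 (K alpha0 alpha1 2) = 0.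
Proof.
rewrite ddtE /K !(tnth_nth 0) /= !mderiv_K2 !mderiv_K3 !mderiv_var a1E /=.
ring.
Qed.

Lemma ddt_K_eq0 (i j : 'I_3) : ddt alpha0 alpha1 j (K alpha0 alpha1 i) = 0.
Proof.
have K_same k : ddt alpha0 alpha1 k (K alpha0 alpha1 k) = 0.
  by rewrite ddtE; ring.
(* By antisymmetry and [K_same], only the three pairs with [j < i] remain. *)
wlog lt_ji : i j / (j < i)%N => [hlt|].
  have [/hlt //|/hlt hji|/val_inj -> //] := ltngtP j i.
  by rewrite ddt_sym hji oppr0.
case: i j lt_ji => [[|[|[|i]]] lti] [[|[|[|j]]] ltj] //= _.
- by rewrite -[RHS]ddt_K12; congr (ddt _ _ _ (K _ _ _)); apply: val_inj.
- by rewrite -[RHS]ddt_K13; congr (ddt _ _ _ (K _ _ _)); apply: val_inj.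
- by rewrite -[RHS]ddt_K23; congr (ddt _ _ _ (K _ _ _)); apply: val_inj.
Qed.

End Involution.

Theorem proposition4p1 (R : realType) (alpha0 alpha1 : R[i])
    (halpha : alpha0 + alpha1 = 0) (i j : 'I_3) (m : 'I_2) :
  ddt alpha0 alpha1 j (dqdt alpha0 alpha1 i m) =
    ddt alpha0 alpha1 i (dqdt alpha0 alpha1 j m) /\
  ddt alpha0 alpha1 j (dpdt alpha0 alpha1 i m) =
    ddt alpha0 alpha1 i (dpdt alpha0 alpha1 j m).
Proof.
have two_neq0 : (2 : R[i]) != 0 by rewrite Num.Theory.pnatr_eq0.
(* One identity serves both conditions: [v = pvar m] for q_m and, up to sign, [v = qvar m] for
   p_m. *)
have commK v : ddt alpha0 alpha1 j (K alpha0 alpha1 i)^`M(v) =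
               ddt alpha0 alpha1 i (K alpha0 alpha1 j)^`M(v).
  by apply: subr0_eq; rewrite ddt_mderiv_sub ddt_K_eq0 // mderiv0.
by rewrite /dqdt /dpdt !ddtN !commK.
Qed.
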